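(* Let $V=W_1\oplus W_2$ be a finite-dimensional vector space over the non-archimedean field $F$, with $W_1,W_2$ nonzero subspaces. Then $Q([\Lambda])$ is a complete invariant of the action of $\mathrm{GL}(W_1)\times\mathrm{GL}(W_2)$ on the set of vertices of the Euclidean building of $\mathrm{GL}(V)$; that is, two vertices $[\Lambda],[\Lambda']$ lie in the same $\mathrm{GL}(W_1)\times\mathrm{GL}(W_2)$-orbit if and only if $Q([\Lambda])=Q([\Lambda'])$.
   Context: $F$ is a non-archimedean field (with a discrete valuation and finite residue field), $\mathcal{O}$ its ring of integers. An $\mathcal{O}$-lattice in a finite-dimensional $F$-vector space is a finitely generated free $\mathcal{O}$-submodule spanning it over $F$. The vertices of the Euclidean building $\mathcal{B}_e\mathrm{GL}(V)$ are the homothety classes $[\Lambda]=\{a\Lambda : a\in F^\times\}$ of lattices $\Lambda\subset V$. $\mathrm{GL}(W_1)\times\mathrm{GL}(W_2)\subset\mathrm{GL}(V)$ acts on vertices by $g[\Lambda]=[g\Lambda]$. Let $p_i:V\to W_i$ ($i=1,2$) be the projections. For a lattice $\Lambda\subset V$ put $P_i(\Lambda)=p_i(\Lambda)$, $K_i(\Lambda)=\Lambda\cap W_i\subset P_i(\Lambda)$, and $Q_i(\Lambda)=P_i(\Lambda)/K_i(\Lambda)$. One has $Q_1(\Lambda)\cong Q_2(\Lambda)$ as $\mathcal{O}$-modules; the common isomorphism class is denoted $Q(\Lambda)$. Since $Q(c\Lambda)=Q(\Lambda)$ for $c\in F^\times$, one writes $Q([\Lambda])=Q(\Lambda)$. 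*)

(* Defs.v *)
From HB Require Import structures.
From mathcomp Require Import all_boot all_order all_algebra.
From mathcomp Require Import boolp classical_sets cardinality.

Set Implicit Arguments.
Unset Strict Implicit.
Unset Printing Implicit Defensive.

Import Order.TTheory GRing.Theory Num.Theory.
Local Open Scope ring_scope.
Local Open Scope quotient_scope.

(* The valuation is normalized (value group exactly int). Its value at 0 is
   junk, standing for +oo: every use below is guarded against 0. *)
Record discrete_valuation (F : fieldType) := DiscreteValuation {
  valuation :> F -> int;
  valuationM : forall x y, x != 0 -> y != 0 ->
    valuation (x * y) = valuation x + valuation y;
  valuationD : forall x y, x != 0 -> y != 0 -> x + y != 0 ->
    Num.min (valuation x) (valuation y) <= valuation (x + y);
  valuation_onto : forall n : int, exists2 x, x != 0 & valuation x = n
}.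

Section IntegerRing.
Variables (F : fieldType) (v : discrete_valuation F).

Definition int_pred : {pred F} := [pred x | (x == 0) || (0 <= v x)].

Lemma valuation1 : v 1 = 0.
Proof.
have h1 : (1 : F) != 0 by exact: oner_neq0.
by have /(canLR (addrK _)) := valuationM v h1 h1; rewrite mulr1 subrr.
Qed.

Lemma valuationN x : x != 0 -> v (- x) = v x.
Proof.
move=> x0; rewrite -mulN1r valuationM ?oppr_eq0 ?oner_neq0 //.
suff -> : v (-1) = 0 by rewrite add0r.
have h1 : (-1 : F) != 0 by rewrite oppr_eq0 oner_neq0.
have := valuationM v h1 h1; rewrite mulrNN mulr1 valuation1 => /esym/eqP.
by rewrite -mulr2n mulrn_eq0 /= => /eqP.
Qed.

Lemma valuationB (P : pred int) x y :
    (forall m n, m <= n -> P m -> P n) ->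
  (x == 0) || P (v x) -> (y == 0) || P (v y) -> (x - y == 0) || P (v (x - y)).
Proof.
move=> Pup; have [->|x0] := eqVneq x 0; have [->|y0] := eqVneq y 0 => //=.
- by rewrite subrr eqxx.
- by rewrite sub0r => _ h; rewrite valuationN ?h ?orbT.
- by rewrite subr0 => h _; rewrite h orbT.
have [//|xy0 hx hy] := eqVneq (x - y) 0.
have yN0 : - y != 0 by rewrite oppr_eq0.
apply: (Pup _ _ (valuationD v x0 yN0 xy0)); rewrite valuationN //.
by case: leP.
Qed.

Fact int_pred_subring : subring_closed int_pred.
Proof.
split=> [|x y|x y]; rewrite !inE.
- by rewrite valuation1 lexx orbT.
- by apply: valuationB => m n /[swap]; exact: le_trans.
have [->|x0] := eqVneq x 0; first by rewrite mul0r eqxx.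
have [->|y0] := eqVneq y 0; first by rewrite mulr0 eqxx.
by rewrite valuationM //= => hx hy; rewrite addr_ge0 ?orbT.
Qed.
HB.instance Definition _ := GRing.isSubringClosed.Build F int_pred int_pred_subring.

Record int_ring := IntRing { int_val :> F; _ : int_val \in int_pred }.
HB.instance Definition _ := [isSub for int_val].
HB.instance Definition _ := [Choice of int_ring by <:].
HB.instance Definition _ := [SubChoice_isSubComNzRing of int_ring by <:].

Definition max_ideal : {pred int_ring} :=
  [pred x | (val x == 0) || (0 < v (val x))].

Fact max_ideal_idealr : idealr_closed max_ideal.
Proof.
split=> [||a x y]; rewrite !inE.
- by rewrite eqxx.
- by rewrite oner_eq0 valuation1 ltxx.
move=> hx hy; rewrite -[y]opprK [val _](_ : _ = int_val a * val x - - val y);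
  last by rewrite opprK opprK.
apply: valuationB => [m n /[swap]||]; first exact: lt_le_trans.
  have := valP a; rewrite inE /=; move: hx; rewrite /=.
  have [->|a0] := eqVneq (int_val a) 0; first by rewrite mul0r eqxx.
  have [->|x0] := eqVneq (int_val x) 0; first by rewrite mulr0 eqxx.
  by rewrite valuationM //= => hx ha; rewrite ltr_wpDl ?orbT.
by rewrite oppr_eq0; move: hy; case: eqVneq => //= y0; rewrite valuationN.
Qed.
HB.instance Definition _ := isIdealr.Build int_ring max_ideal max_ideal_idealr.

Definition residue_field := {ideal_quot max_ideal}.

End IntegerRing.

Section Submodules.
Variables (A : nzRingType) (M : lmodType A).

Record submod (S : submodClosed M) := Submod { submod_val :> M; _ : submod_val \in S }.
HB.instance Definition _ S := [isSub for @submod_val S].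
HB.instance Definition _ S := [Choice of submod S by <:].
HB.instance Definition _ S := [SubChoice_isSubLmodule of submod S by <:].

Lemma submodClosed_eq (S S' : submodClosed M) : S =i S' -> S = S'.
Proof.
case: S S' => [S cS] [S' cS'] eqSS'.
have e : S = S' by apply/funext => x; exact: eqSS'.
subst S'; congr (GRing.SubmodClosed.Pack _).
case: cS cS' {eqSS'} => [[p] [r]] [[p'] [r']].
by rewrite (Prop_irrelevance p p') (Prop_irrelevance r r').
Qed.

Lemma submodClosedB (S : submodClosed M) : {in S &, forall x y, x - y \in S}.
Proof. exact: (GRing.submod_closedB (GRing.submodClosedP S)).2. Qed.

Section Quotient.
Variables P K : submodClosed M.

Definition inner_pred : {pred submod P} := [pred x | val x \in K].

Fact inner_submod_closed : submod_closed inner_pred.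
Proof.
split=> [|a x y]; rewrite !inE ?raddf0 ?rpred0 // => hx hy.
by rewrite linearP rpredD // rpredZ.
Qed.
HB.instance Definition _ :=
  GRing.isSubmodClosed.Build A (submod P) inner_pred inner_submod_closed.
HB.instance Definition _ := GRing.isZmodClosed.Build (submod P) inner_pred
  (GRing.submod_closedB inner_submod_closed).

(* The library's quotient of the abelian group P by the subgroup P :&: K,
   equipped below with its A-module structure. *)
Definition subquotient := Quotient.quot inner_pred.
HB.instance Definition _ : EqQuotient _ (Quotient.equiv inner_pred) subquotient :=
  EqQuotient.on subquotient.
HB.instance Definition _ := GRing.Zmodule.on subquotient.
HB.instance Definition _ := @isZmodQuotient.Build (submod P)
  (Quotient.equiv inner_pred) 0 -%R +%R subquotient
  (lock _) (@Quotient.pi_opp _ _) (@Quotient.pi_add _ _).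

Definition subquotient_scale (a : A) (x : subquotient) : subquotient :=
  \pi_subquotient (a *: repr x).

Lemma subquotient_eqP (x y : submod P) :
  reflect (\pi_subquotient x = \pi_subquotient y) (val x - val y \in K).
Proof. by rewrite -raddfB -[_ \in K]/(x - y \in inner_pred) Quotient.idealrBE; exact: eqP. Qed.

Lemma pi_subquotientZ a (x : submod P) :
  \pi_subquotient (a *: x) = subquotient_scale a (\pi_subquotient x).
Proof.
apply/eqP; rewrite -Quotient.idealrBE -scalerBr rpredZ //.
by rewrite Quotient.idealrBE reprK.
Qed.

Fact subquotient_scaleA a b x :
  subquotient_scale a (subquotient_scale b x) = subquotient_scale (a * b) x.
Proof. by elim/(@quotW _ subquotient): x => x; rewrite -!pi_subquotientZ scalerA. Qed.

Fact subquotient_scale1 : left_id 1 subquotient_scale.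
Proof. by elim/(@quotW _ subquotient) => x; rewrite -pi_subquotientZ scale1r. Qed.

Fact subquotient_scaleDr : right_distributive subquotient_scale +%R.
Proof.
move=> a; elim/(@quotW _ subquotient) => x; elim/(@quotW _ subquotient) => y.
by rewrite -raddfD -!pi_subquotientZ -raddfD scalerDr.
Qed.

Fact subquotient_scaleDl x : {morph subquotient_scale^~ x : a b / a + b}.
Proof.
by elim/(@quotW _ subquotient): x => x a b; rewrite -!pi_subquotientZ -raddfD scalerDl.
Qed.

HB.instance Definition _ := GRing.Zmodule_isLmodule.Build A subquotient
  subquotient_scaleA subquotient_scale1 subquotient_scaleDr subquotient_scaleDl.

Fact pi_subquotient_scalable : scalable \pi_subquotient.
Proof. by move=> a x; rewrite pi_subquotientZ. Qed.
HB.instance Definition _ := GRing.isScalable.Build A (submod P) subquotient *:%R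
  \pi_subquotient pi_subquotient_scalable.

End Quotient.
End Submodules.

Definition lmod_iso (A : nzRingType) (M N : lmodType A) : Prop :=
  exists f : {linear M -> N}, bijective f.

Section LmodIso.
Variable A : nzRingType.
Implicit Types M N : lmodType A.

Lemma lmod_iso_ker M N N' (f : {linear M -> N}) (f' : {linear M -> N'}) :
    (forall y, exists x, f x = y) -> (forall y, exists x, f' x = y) ->
    (forall x, f x = 0 <-> f' x = 0) ->
  lmod_iso N N'.
Proof.
move=> /choice[g fg] /choice[g' fg'] ker.
have ff' x y : f x = f y -> f' x = f' y.
  by move/eqP; rewrite -subr_eq0 -raddfB => /eqP/ker/eqP; rewrite raddfB subr_eq0 => /eqP.
have f'f x y : f' x = f' y -> f x = f y.
  by move/eqP; rewrite -subr_eq0 -raddfB => /eqP/ker/eqP; rewrite raddfB subr_eq0 => /eqP.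
pose h y := f' (g y).
have hlin : linear h.
  by move=> a x y; rewrite /h -linearP; apply: ff'; rewrite linearP !fg.
pose H := GRing.isLinear.Build A N N' *:%R h hlin.
pose hL : {linear N -> N'} := HB.pack h H.
exists hL; exists (fun z => f (g' z)) => [y|z] /=.
  by rewrite -[RHS]fg; apply: f'f; rewrite fg'.
by rewrite /h -[RHS]fg'; apply: ff'; rewrite fg.
Qed.

Lemma lmod_iso_refl M : lmod_iso M M.
Proof. by exists idfun; exists id. Qed.

Lemma lmod_iso_sym M N : lmod_iso M N -> lmod_iso N M.
Proof.
move=> [f fbij]; have [g fK gK] := fbij.
by apply: (@lmod_iso_ker M N M f idfun) => [y|y|x] /=;
   [exists (g y)|exists y|split=> [/eqP|->]; rewrite ?linear0 // ;
    rewrite -(linear0 f) => /eqP /(can_inj fK)].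
Qed.

Lemma lmod_iso_trans M N P : lmod_iso M N -> lmod_iso N P -> lmod_iso M P.
Proof.
by move=> [f fb] [g gb]; exists (g \o f); exact: bij_comp.
Qed.

End LmodIso.

Section RestrictionOfScalars.
Variables (F : fieldType) (v : discrete_valuation F) (V : vectType F).

(* V seen as a module over the integer ring of v; the argument v is unused but
   lets the canonical scalar ring be inferred. *)
Definition restrict of discrete_valuation F : Type := V.
Local Notation V_O := (restrict v).
HB.instance Definition _ := GRing.Zmodule.on V_O.

Definition restrict_scale (a : int_ring v) (x : V_O) : V_O :=
  int_val a *: (x : V).

Fact restrict_scaleA a b x :
  restrict_scale a (restrict_scale b x) = restrict_scale (a * b) x.
Proof. exact: scalerA. Qed.
Fact restrict_scale1 : left_id 1 restrict_scale.
Proof. exact: scale1r. Qed.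
Fact restrict_scaleDr : right_distributive restrict_scale +%R.
Proof. by move=> a x y; exact: scalerDr. Qed.
Fact restrict_scaleDl x : {morph restrict_scale^~ x : a b / a + b}.
Proof. by move=> a b; exact: scalerDl. Qed.
HB.instance Definition _ := GRing.Zmodule_isLmodule.Build (int_ring v) V_O
  restrict_scaleA restrict_scale1 restrict_scaleDr restrict_scaleDl.

Implicit Types L : submodClosed V_O.

Section Image.
Variables (f : 'End(V)) (L : submodClosed V_O).

Definition submod_image_pred : {pred V_O} :=
  [pred y | `[< exists2 x : V, x \in L & y = f x >]].

Fact submod_image_closed : submod_closed submod_image_pred.
Proof.
split=> [|a y z].
  by apply/asboolP; exists 0; [exact: (rpred0 L)|rewrite linear0].
move=> /asboolP[x xL ->] /asboolP[x' x'L ->]; apply/asboolP.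
exists (int_val a *: x + x'); last by rewrite linearP.
exact: (rpredD (@rpredZ _ _ L a x xL) x'L).
Qed.
HB.instance Definition _ :=
  GRing.isSubmodClosed.Build (int_ring v) V_O submod_image_pred submod_image_closed.

Definition submod_image : submodClosed V_O := submod_image_pred.

End Image.

Section Inter.
Variables (W : {vspace V}) (L : submodClosed V_O).

Definition submod_inter_pred : {pred V_O} := [pred x | (x \in L) && ((x : V) \in W)].

Fact submod_inter_closed : submod_closed submod_inter_pred.
Proof.
split=> [|a x y]; first by rewrite inE rpred0 mem0v.
rewrite !inE => /andP[xL xW] /andP[yL yW]; apply/andP; split.
  by rewrite rpredD // rpredZ.
by rewrite memvD // memvZ.
Qed.
HB.instance Definition _ :=
  GRing.isSubmodClosed.Build (int_ring v) V_O submod_inter_pred submod_inter_closed.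

Definition submod_inter : submodClosed V_O := submod_inter_pred.

End Inter.

(* First conjunct: L is free of finite rank over the integer ring; second: its
   F-span is V. *)
Definition is_lattice L : Prop :=
  (exists n : nat, lmod_iso 'rV[int_ring v]_n (submod L)) /\
  (exists2 s : seq V, {subset s <= L} & <<s>>%VS = fullv).

Definition homothety (a : F) L : submodClosed V_O := submod_image (a *: \1%VF) L.

Definition homothety_class L : set (submodClosed V_O) :=
  [set homothety a L | a in [set a : F | a != 0]]%classic.

Definition is_vertex (x : set (submodClosed V_O)) : Prop :=
  exists2 L, is_lattice L & x = homothety_class L.

End RestrictionOfScalars.

Section Invariant.
Variables (F : fieldType) (v : discrete_valuation F) (V : vectType F).
Variables W1 W2 : {vspace V}.
Implicit Types L : submodClosed (restrict V v).

(* [daddv_pi U U'] is the projection onto U along U'. *)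
Definition P1 L := submod_image (daddv_pi W1 W2) L.
Definition P2 L := submod_image (daddv_pi W2 W1) L.
Definition K1 L := submod_inter W1 L.
Definition K2 L := submod_inter W2 L.
Definition Q1 L : lmodType (int_ring v) := subquotient (P1 L) (K1 L).
Definition Q2 L : lmodType (int_ring v) := subquotient (P2 L) (K2 L).

Definition iso_class (A : nzRingType) (M : lmodType A) : lmodType A -> Prop :=
  fun N => lmod_iso M N.

(* The isomorphism class Q([L]); Q_vertex_class shows that it does not depend on
   the representative L, and Q1_iso_Q2 that using Q2 gives the same class. *)
Definition Q_vertex (x : set (submodClosed (restrict V v))) :
    lmodType (int_ring v) -> Prop :=
  fun N => exists2 L, x L & iso_class (Q1 L) N.

Section ImageMap.
Variables (f : 'End(V)) (L : submodClosed (restrict V v)).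

Fact submod_image_mem (x : submod L) :
  (f (submod_val x) : restrict V v) \in submod_image f L.
Proof. by case: x => x xL; apply/asboolP; exists x. Qed.

Definition image_map (x : submod L) : submod (submod_image f L) :=
  Submod (submod_image_mem x).

Fact image_map_linear : linear image_map.
Proof. by move=> a x y; apply/val_inj; exact: (linearP f). Qed.
HB.instance Definition _ := GRing.isLinear.Build (int_ring v) (submod L)
  (submod (submod_image f L)) *:%R image_map image_map_linear.

Lemma image_map_surj y : exists x, image_map x = y.
Proof.
case: y => y yP; have /asboolP[x xL e] := yP.
by exists (Submod xL); apply/val_inj; rewrite /= e.
Qed.

Variable K : submodClosed (restrict V v).

Definition image_quot : submod L -> subquotient (submod_image f L) K :=
  \pi_(subquotient (submod_image f L) K) \o image_map.
HB.instance Definition _ := GRing.Linear.on image_quot.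

Lemma image_quot_surj y : exists x, image_quot x = y.
Proof.
have [x e] := image_map_surj (repr y).
by exists x; rewrite /image_quot /= e reprK.
Qed.

Lemma image_quot_eq0 x : image_quot x = 0 <-> (f (submod_val x) : restrict V v) \in K.
Proof.
rewrite -(linear0 (\pi_(subquotient (submod_image f L) K))).
rewrite (rwP (subquotient_eqP _ _ _)) /= subr0.
by [].
Qed.

End ImageMap.

Section Invariance.
Hypothesis W12_direct : directv (W1 + W2).
Hypothesis W12_full : (W1 + W2 = fullv)%VS.

Let capW : (W1 :&: W2 = 0)%VS. Proof. exact/directv_addP. Qed.
Let capW' : (W2 :&: W1 = 0)%VS. Proof. by rewrite capvC. Qed.
Let decW x : daddv_pi W1 W2 x + daddv_pi W2 W1 x = x.
Proof. by apply: daddv_pi_add => //; rewrite W12_full memvf. Qed.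

Lemma Q1_iso_Q2 L : lmod_iso (Q1 L) (Q2 L).
Proof.
apply: (@lmod_iso_ker _ (submod L) (Q1 L) (Q2 L)
  (@image_quot (daddv_pi W1 W2) L (K1 L)) (@image_quot (daddv_pi W2 W1) L (K2 L)));
  [exact: image_quot_surj|exact: image_quot_surj|move=> x].
rewrite !image_quot_eq0 !inE !memv_pi !andbT.
have xL : submod_val x \in L by exact: valP.
have := decW (submod_val x).
set p := daddv_pi W1 W2 _; set q := daddv_pi W2 W1 _ => pq.
split=> [pL|qL].
  by have := submodClosedB xL pL; rewrite -pq [_ - _]addrAC subrr add0r.
by have := submodClosedB xL qL; rewrite -pq [_ - _]addrK.
Qed.

Lemma Q1_homothety a L : a != 0 -> lmod_iso (Q1 L) (Q1 (homothety a L)).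
Proof.
move=> a0; set aL := homothety a L.
apply: (@lmod_iso_ker _ (submod L) (Q1 L) (Q1 aL)
  (@image_quot (daddv_pi W1 W2) L (K1 L))
  (@image_quot (daddv_pi W1 W2) aL (K1 aL) \o @image_map (a *: \1%VF) L)).
- exact: image_quot_surj.
- move=> y; have [z <-] := image_quot_surj y.
  by have [x <-] := image_map_surj z; exists x.
move=> x /=; rewrite !image_quot_eq0 !inE !memv_pi !andbT /=.
rewrite scale_lfunE id_lfunE linearZ /=.
split=> [h|/asboolP[y yL]]; first by apply/asboolP; exists (daddv_pi W1 W2 (submod_val x)); rewrite ?scale_lfunE ?id_lfunE.
by rewrite scale_lfunE id_lfunE => /(scalerI a0) ->.
Qed.

Lemma Q_vertex_class L : Q_vertex (homothety_class L) = iso_class (Q1 L).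
Proof.
apply/funext => N; apply/propext; split=> [[_ [a a0 <-]]|h].
  by move=> h; apply: lmod_iso_trans (Q1_homothety L a0) h.
exists (homothety 1 L); first by exists 1; rewrite /= ?oner_neq0.
by apply: lmod_iso_trans h; apply/lmod_iso_sym/Q1_homothety; exact: oner_neq0.
Qed.

End Invariance.

Record GL (U : vectType F) := GLmap { gl_fun :> 'End(U); gl_bij : bijective gl_fun }.

(* The block-diagonal map g.1 (+) g.2 of V = W1 (+) W2. *)
Definition GL_prod (g : GL (subvs_of W1) * GL (subvs_of W2)) : 'End(V) :=
  (linfun vsval \o g.1 \o linfun (vsproj W1) \o daddv_pi W1 W2)%VF
  + (linfun vsval \o g.2 \o linfun (vsproj W2) \o daddv_pi W2 W1)%VF.

Definition GL_act g (x : set (submodClosed (restrict V v))) :=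
  [set submod_image (GL_prod g) L | L in x]%classic.

Lemma GL_act_class g L :
  GL_act g (homothety_class L) = homothety_class (submod_image (GL_prod g) L).
Proof.
have comm a : submod_image (GL_prod g) (homothety a L) =
              homothety a (submod_image (GL_prod g) L).
  apply/submodClosed_eq => y; apply/asboolP/asboolP.
    move=> [_ /asboolP[x xL ->] ->]; exists (GL_prod g x).
      by apply/asboolP; exists x.
    by rewrite !scale_lfunE !id_lfunE linearZ.
  move=> [_ /asboolP[x xL ->] ->]; exists ((a *: \1%VF) x).
    by apply/asboolP; exists x.
  by rewrite !scale_lfunE !id_lfunE linearZ.
apply/seteqP; split=> [_ [_ [a a0 <-] <-]|_ [a a0 <-]].
  by exists a.
by exists (homothety a L); [exists a|rewrite comm].
Qed.

End Invariant.

(* Main.v *)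
(* A lattice L is the fibre product of P1 L and P2 L over Q L, so it is encoded
   by two bases and two surjections O^n -> Q L <- O^m. Matrices over the local
   ring O have stable range one, so an isomorphism Q L -> Q L' lifts through any
   two surjections from O^n to an invertible matrix. The two lifts so obtained
   are the components of an element of GL(W1) x GL(W2) mapping L to L'. *)
Require Import Defs.
From HB Require Import structures.
From mathcomp Require Import all_boot all_order all_algebra.
From mathcomp Require Import boolp classical_sets cardinality.

Set Implicit Arguments.
Unset Strict Implicit.
Unset Printing Implicit Defensive.

Import Order.TTheory GRing.Theory Num.Theory.
Local Open Scope ring_scope.
Local Open Scope quotient_scope.

(** * Stable range one for matrices and lifting of isomorphisms *)

(** Rank normal form gives [A = L D R] with [D] idempotent. Taking [Y = L (1 - D) R] fills the
    missing rank: since [C = 1 - B A], the sum becomes [L (1 - N) R] with [N = (1 - D) R B L D]. As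
    [D (1 - D) = 0], [N] squares to zero. *)
Lemma stable_range_mx_field (k : fieldType) n (A B C : 'M[k]_n) :
  B *m A + C = 1%:M -> exists Y, A + Y *m C \in unitmx.
Proof.
move=> BAC; set L := col_ebase A; set R := row_ebase A.
have [Lu Ru] : L \in unitmx /\ R \in unitmx.
  by rewrite col_ebase_unit row_ebase_unit.
pose D : 'M[k]_n := pid_mx (\rank A).
have eA : A = L *m D *m R by rewrite mulmx_ebase.
have DD : D *m D = D by rewrite pid_mx_id // rank_leq_row.
have DC : D *m (1%:M - D) = 0 by rewrite mulmxBr mulmx1 DD subrr.
exists (L *m (1%:M - D) *m R).
pose N := (1%:M - D) *m R *m B *m L *m D.
have -> : A + L *m (1%:M - D) *m R *m C = L *m (1%:M - N) *m R.
  have -> : C = 1%:M - B *m A by rewrite -BAC addrC addKr.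
  have DT : D + (1%:M - D) = 1%:M by rewrite addrC subrK.
  rewrite /N; move: (1%:M - D) DT => T DT.
  rewrite [in B *m A]eA [in A + _]eA mulmxBr mulmx1 addrA -mulmxDl -mulmxDr DT.
  by rewrite !(mulmxBr L) mulmxBl !mulmxA.
have NN : N *m N = 0.
  by rewrite {1}/N /N -[X in X *m _]mulmxA !mulmxA -(mulmxA _ D) DC mulmx0 !mul0mx.
rewrite !unitmx_mul Lu Ru andbT /=.
(* The inverse of [1 - N] is the geometric series, which stops after [1 + N]. *)
suff /mulmx1_unit[] : (1%:M - N) *m (1%:M + N) = 1%:M by [].
by rewrite mulmxDr mulmx1 mulmxBl mul1mx NN subr0 subrK.
Qed.

Section LocalRing.
Variables (R : comNzRingType) (k : fieldType) (phi : {rmorphism R -> k}).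
Hypothesis phi_surj : forall y, exists x, phi x = y.
Hypothesis phi_unit : forall x, phi x != 0 -> exists y, x * y = 1.

(** Solve over the residue field and lift the solution entrywise. The determinant then has nonzero
    image in [k], so it is invertible in [R], and the adjugate provides the inverse. *)
Lemma stable_range_mx n (A B C : 'M[R]_n) :
  B *m A + C = 1%:M ->
  exists Y Z, (A + Y *m C) *m Z = 1%:M /\ Z *m (A + Y *m C) = 1%:M.
Proof.
move=> /(congr1 (map_mx phi)); rewrite map_mxD map_mxM map_mx1.
move=> /stable_range_mx_field[Y0 u]; have [s sK] := choice phi_surj.
pose Y := map_mx s Y0.
have eY : map_mx phi Y = Y0 by apply/matrixP => i j; rewrite !mxE sK.
exists Y; set G := A + _.
have [y dy] : exists y, \det G * y = 1.
  apply: phi_unit; rewrite -det_map_mx map_mxD map_mxM eY.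
  by rewrite -unitfE -unitmxE.
exists (y *: \adj G); split.
  by rewrite -scalemxAr mul_mx_adj scale_scalar_mx mulrC dy.
by rewrite -scalemxAl mul_adj_mx scale_scalar_mx mulrC dy.
Qed.

(** Freeness lifts [psi] to a matrix [A] and its inverse to a matrix [B], neither of them invertible
    in general. Stable range one corrects [A] without changing the map that it induces. *)
Lemma lift_iso_free n (M N : lmodType R) (p : {linear 'rV[R]_n -> M})
    (q : {linear 'rV[R]_n -> N}) (psi : {linear M -> N}) :
    (forall m, exists x, p x = m) -> (forall m, exists x, q x = m) ->
    bijective psi ->
  exists G Z : 'M[R]_n, [/\ G *m Z = 1%:M, Z *m G = 1%:M
    & forall x, q (x *m G) = psi (p x)].
Proof.
move=> p_surj q_surj [psi' psiK psi'K].
have lift (N' : lmodType R) (r : {linear 'rV[R]_n -> N'}) (t : 'I_n -> N') :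
    (forall m, exists x, r x = m) ->
    exists A : 'M_n, forall i, r (row i A) = t i.
  move=> /choice[s sK]; exists (\matrix_i s (t i)) => i.
  by rewrite rowK sK.
have [A eA] := lift N q (fun i => psi (p (delta_mx 0 i))) q_surj.
have [B eB] := lift M p (fun i => psi' (q (delta_mx 0 i))) p_surj.
have lin (N' : lmodType R) (r1 r2 : {linear 'rV[R]_n -> N'}) :
    (forall i, r1 (delta_mx 0 i) = r2 (delta_mx 0 i)) -> forall x, r1 x = r2 x.
  move=> r12 x; rewrite (row_sum_delta x) !raddf_sum /=.
  by apply: eq_bigr => i _; rewrite !linearZ r12.
have qA x : q (x *m A) = psi (p x).
  apply: (lin N (q \o mulmxr A)%FUN (psi \o p)%FUN) => i /=.
  by rewrite -rowE eA.
have pB x : psi (p (x *m B)) = q x.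
  apply: (lin N (psi \o (p \o mulmxr B))%FUN q) => i /=.
  by rewrite -rowE eB psi'K.
(* [1 - B A] maps into the kernel of [q], so [A + Y (1 - B A)] lifts [psi] for every [Y]. *)
have qC x : q (x *m (1%:M - B *m A)) = 0.
  by rewrite mulmxBr mulmx1 mulmxA linearB /= qA pB subrr.
have [|Y [Z [GZ ZG]]] := @stable_range_mx _ A B (1%:M - B *m A).
  by rewrite addrC subrK.
exists (A + Y *m (1%:M - B *m A)), Z; split=> // x.
by rewrite mulmxDr linearD /= qA mulmxA qC addr0.
Qed.

End LocalRing.

(** * The integer ring is local *)

Section Residue.
Variables (F : fieldType) (v : discrete_valuation F).
Local Notation O := (int_ring v).
Local Notation k0 := {ideal_quot (@max_ideal F v)}.

Lemma int_predE (x : F) : (x \in int_pred v) = (x == 0) || (0 <= v x).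
Proof. by []. Qed.

Lemma max_ideal_unit (x : O) : x \notin @max_ideal F v -> exists y : O, x * y = 1.
Proof.
have := valP x; rewrite /max_ideal !inE negb_or /= -leNgt.
case: eqP => [//|/eqP x0] /= vx0 vx1.
have vx : v (val x) = 0 by apply/eqP; rewrite eq_le vx1.
have yP : (val x)^-1 \in int_pred v.
  have := valuationM v x0 (invr_neq0 x0); rewrite divff // valuation1 vx add0r.
  by rewrite int_predE => <-; rewrite lexx orbT.
by exists (IntRing yP); apply/val_inj; rewrite /= divff.
Qed.

Lemma residue_pi_eq0 (x : O) :
  (\pi_(k0) x == 0) = (x \in @max_ideal F v).
Proof. by rewrite -[x in RHS]subr0 Quotient.idealrBE raddf0. Qed.

(** Supplies the [k] and [phi] that the section on local rings asks for: the quotient by [max_ideal]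
    is a commutative ring, and inverses chosen by representatives make it a field. *)
Lemma residue_field_exists :
  exists (k : fieldType) (phi : {rmorphism O -> k}),
    (forall y, exists x, phi x = y)
    /\ (forall x, phi x != 0 -> exists y, x * y = 1).
Proof.
(* The second conjunct is the convention that the inverse of 0 is 0, which the field structure
   demands. *)
have inv_ex (y : k0) :
    exists z, (y != 0 -> z * y = 1) /\ (y = 0 -> z = 0).
  have [->|y0] := eqVneq y 0; first by exists 0.
  have : repr y \notin @max_ideal F v by rewrite -residue_pi_eq0 reprK.
  move=> /max_ideal_unit[x xy]; exists (\pi x); split=> [_|e].
    by rewrite -[y]reprK -rmorphM mulrC xy rmorph1.
  by rewrite e eqxx in y0.
have [inv invP] := choice inv_ex.
pose fM := GRing.ComNzRing_isField.Build k0
  (fun y => (invP y).1) ((invP 0).2 erefl).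
pose k : fieldType := HB.pack k0 fM.
exists k, (\pi_(k0) : {rmorphism O -> k0}); split.
  by move=> y; exists (repr (y : k0)); exact: (@reprK _ k0).
move=> x x0; apply: max_ideal_unit.
by rewrite -residue_pi_eq0.
Qed.
End Residue.

(** * Linear combinations as maps out of a free module *)

Section LinearCombinations.
Variables (R : nzRingType) (M : lmodType R) (n : nat) (e : 'I_n -> M).

Definition lincomb (a : 'rV[R]_n) : M := \sum_i a 0 i *: e i.

Fact lincomb_linear : linear lincomb.
Proof.
move=> a x y; rewrite /lincomb scaler_sumr -big_split /=.
by apply: eq_bigr => i _; rewrite !mxE scalerDl scalerA.
Qed.
HB.instance Definition _ := GRing.isLinear.Build R 'rV[R]_n M *:%R lincomb
  lincomb_linear.

Lemma lincomb_delta i : lincomb (delta_mx 0 i) = e i.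
Proof.
rewrite /lincomb (bigD1 i) //= big1 => [|j ji].
  by rewrite !mxE !eqxx scale1r addr0.
by rewrite !mxE (negbTE ji) scale0r.
Qed.

End LinearCombinations.

Lemma linear_lincomb (R : nzRingType) (M N : lmodType R) (f : {linear M -> N})
    n (e : 'I_n -> M) a : f (lincomb e a) = lincomb (f \o e) a.
Proof. by rewrite /lincomb linear_sum; apply: eq_bigr => i _; rewrite linearZ. Qed.

Lemma linear_rowE (R : nzRingType) (M : lmodType R) n (f : {linear 'rV[R]_n -> M}) a :
  f a = lincomb (fun i => f (delta_mx 0 i)) a.
Proof.
rewrite [in LHS](row_sum_delta a) raddf_sum /=.
by apply: eq_bigr => i _; rewrite linearZ.
Qed.

(** * Bases of projected lattices *)

Section Lattices.
Variables (F : fieldType) (v : discrete_valuation F) (V : vectType F).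
Local Notation O := (int_ring v).
Local Notation V_O := (restrict V v).
Local Notation icomb t := (lincomb (tnth t : _ -> V_O)).

(** The bound is required only for nonzero [x], because [v 0] is a junk value. *)
Lemma valuation_div_int (x y : F) : y != 0 -> (x != 0 -> v y <= v x) ->
  exists c : O, int_val c = x / y.
Proof.
move=> y0 yx; suff cP : x / y \in int_pred v by exists (IntRing cP).
rewrite int_predE; have [->|x0] := eqVneq x 0; first by rewrite mul0r eqxx.
have := valuationM v (mulf_neq0 x0 (invr_neq0 y0)) y0.
by rewrite divfK // => e; rewrite -(lerD2r (v y)) -e add0r yx ?orbT.
Qed.

(* In a linear relation over F, dividing by a coefficient of least valuation
   expresses its vector as an integral combination of the others. *)
Lemma free_generators n (e : 'I_n -> V_O) :
  exists m (t : m.-tuple V), free t /\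
    forall x, (exists a, lincomb (e : 'I_n -> V_O) a = x) <-> (exists a, icomb t a = x).
Proof.
elim: n => [|n IH] in e *.
  exists 0%N, [tuple]; split; first exact: nil_free.
  by move=> x; split=> -[a <-]; exists a; rewrite /lincomb !big_ord0.
pose s : n.+1.-tuple V := [tuple e i | i < n.+1].
have tse : tnth s = e by apply/funext => i; rewrite tnth_mktuple.
have [sfree|] := boolP (free s); first by exists n.+1, s; rewrite tse.
move=> /negP sNfree.
have [k sum0 [i0 ki0]] : exists2 k : 'I_n.+1 -> F,
    \sum_i k i *: (e i : V) = 0 & exists i, k i != 0.
  apply: contrapT => H; apply/sNfree/freeP => k sum0 i; apply: contrapT => /eqP ki.
  apply: H; exists k; last by exists i.
  by rewrite -[RHS]sum0; apply: eq_bigr => j _; rewrite -tnth_nth tse.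
have [j kj jmin] : exists2 j, k j != 0 & forall i, k i != 0 -> v (k j) <= v (k i).
  have [j] := @arg_minP _ _ _ i0 (fun i => k i != 0) (fun i => v (k i)) ki0.
  by exists j.
have /choice[c cE] i : exists c : O, int_val c = - k (lift j i) / k j.
  apply: valuation_div_int => //; rewrite oppr_eq0 => ki.
  by rewrite valuationN // jmin.
pose e' := e \o lift j.
have ej : e j = lincomb e' (\row_i c i).
  move: sum0; rewrite (bigD1_ord j) //= => /eqP; rewrite addr_eq0 => /eqP sum0.
  apply: (scalerI kj); rewrite [LHS]sum0 [RHS]scaler_sumr -sumrN.
  apply: eq_bigr => i _; rewrite mxE [RHS](scalerA _ (int_val (c i))) cE.
  by rewrite mulrCA divff // mulr1 scaleNr.
have [m [t [tfree tE]]] := IH e'; exists m, t; split=> // x; rewrite -tE.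
split=> -[a <-].
  exists (\row_i a 0 (lift j i) + a 0 j *: \row_i c i).
  rewrite linearD linearZ /= -ej [RHS](bigD1_ord j) //= addrC; congr (_ + _).
  by apply: eq_bigr => i _; rewrite mxE.
exists (\row_i (if unlift j i is Some i' then a 0 i' else 0)).
rewrite [LHS](bigD1_ord j) //= mxE unlift_none scale0r add0r.
by apply: eq_bigr => i _; rewrite mxE liftK.
Qed.

Lemma lincomb_span n (t : n.-tuple V) a : icomb t a \in <<t>>%VS.
Proof.
apply: (@memv_suml _ _ _ _ _ (fun i => int_val (a 0 i) *: (tnth t i : V))) => i _.
by rewrite memvZ // memv_span // mem_tnth.
Qed.

(** The images under [f] of generators of [L] generate the image lattice, and [free_generators]
    replaces them by an [F]-free family. It spans [limg f] because [L] spans [V]. *)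
Lemma lattice_image_basis (L : submodClosed V_O) (f : 'End(V)) :
  is_lattice L ->
  exists t : (\dim (limg f)).-tuple V, basis_of (limg f) t /\
    forall u : V, (exists2 z : V, z \in L & f z = u) <-> (exists a, icomb t a = u).
Proof.
move=> [[n [h [h' hK h'K]]] [s sL sV]].
pose e i : V := submod_val (h (delta_mx 0 i)).
have Le (z : V) : z \in L <-> exists a, lincomb (e : 'I_n -> V_O) a = z.
  have eE a : lincomb (e : 'I_n -> V_O) a = submod_val (h a).
    by rewrite [h a]linear_rowE [RHS](linear_lincomb val).
  split=> [zL|[a <-]]; last by rewrite eE; exact: valP.
  by exists (h' (Submod zL)); rewrite eE h'K.
have [m [t [tfree tE]]] := free_generators (f \o e : 'I_n -> V_O).
have imE (u : V) : (exists2 z : V, z \in L & f z = u) <-> (exists a, icomb t a = u).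
  have fE a : f (lincomb (e : 'I_n -> V_O) a) = lincomb (f \o e : 'I_n -> V_O) a.
    by rewrite [LHS]linear_sum; apply: eq_bigr => i _; exact: linearZ.
  rewrite -tE; split=> [[z /Le[a <-] <-]|[a <-]]; first by exists a.
  by exists (lincomb (e : 'I_n -> V_O) a) => //; apply/Le; exists a.
have tB : basis_of (limg f) t.
  rewrite /basis_of tfree andbT eqEsubv; apply/andP; split.
    apply/span_subvP => u /tnthP[i ->].
    have [|z _ <-] := (imE (tnth t i)).2; last by rewrite memv_img ?memvf.
    by exists (delta_mx 0 i); rewrite lincomb_delta.
  rewrite -sV limg_span; apply/span_subvP => _ /mapP[z /sL zL ->].
  by have [|a <-] := (imE (f z)).1; [exists z|exact: lincomb_span].
(* The number [m] of generators is the dimension of [limg f], which fixes the length of the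
   tuple. *)
have := size_basis tB => em; move: t tB {tfree tE} imE; rewrite -em => t tB imE.
by exists t.
Qed.

(** The rows of [G] give the new vectors. The old ones are recovered through [Z], so [n] vectors
    span [W] and form a basis. *)
Lemma basis_change n (W : {vspace V}) (e : n.-tuple V) (G Z : 'M[O]_n) :
    basis_of W e -> Z *m G = 1%:M ->
  exists e' : n.-tuple V, basis_of W e' /\ forall x, icomb e' x = icomb e (x *m G).
Proof.
move=> eW ZG; pose e' : n.-tuple V := [tuple icomb e (row i G) | i < n].
have e'E x : icomb e' x = icomb e (x *m G).
  rewrite -[RHS]/((icomb e \o mulmxr G) x) [RHS]linear_rowE.
  by apply: eq_bigr => i _; rewrite /e' tnth_mktuple /= -rowE.
exists e'; split=> //; rewrite basisEdim (size_basis eW) size_tuple leqnn andbT.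
rewrite -(span_basis eW); apply/span_subvP => u /tnthP[i ->].
rewrite -(lincomb_delta (tnth e : 'I_n -> V_O) i) -[delta_mx 0 i]mulmx1 -ZG mulmxA -e'E.
exact: lincomb_span.
Qed.

End Lattices.

(** * Block-diagonal automorphisms *)

Section BlockMaps.
Variables (F : fieldType) (V : vectType F).

(** The map is defined by coordinates in [e]. Bijectivity comes from the map built the other way
    round: both composites fix a basis. *)
Lemma GL_of_bases n (W : {vspace V}) (e e' : n.-tuple V) :
    basis_of W e -> basis_of W e' ->
  exists g : GL (subvs_of W),
    forall i, vsval (g (vsproj W (tnth e i))) = tnth e' i.
Proof.
move=> eW e'W.
have map_ex (s t : n.-tuple V) : basis_of W s -> basis_of W t ->
    exists h : 'End(subvs_of W),
      forall i, h (vsproj W (tnth s i)) = vsproj W (tnth t i).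
  move=> sW tW.
  pose h (w : subvs_of W) := \sum_i coord s i (vsval w) *: vsproj W (tnth t i).
  have hlin : linear h.
    move=> a x y; rewrite /h scaler_sumr -big_split /=; apply: eq_bigr => i _.
    by rewrite !linearP /= scalerDl scalerA.
  pose H := GRing.isLinear.Build _ _ _ _ h hlin.
  pose hL : {linear subvs_of W -> subvs_of W} := HB.pack h H.
  exists (linfun hL) => i; rewrite lfunE /= /h vsprojK; last first.
    by rewrite (basis_mem sW) ?mem_tnth.
  rewrite (bigD1 i) //= big1 => [|j ji];
    rewrite (tnth_nth 0 s) coord_free ?(basis_free sW) //.
    by rewrite eqxx scale1r addr0.
  by rewrite eq_sym (negbTE ji) scale0r.
have [h hE] := map_ex e e' eW e'W; have [h' h'E] := map_ex e' e e'W eW.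
have inv (s t : n.-tuple V) (f f' : 'End(subvs_of W)) : basis_of W s ->
    (forall i, f (vsproj W (tnth s i)) = vsproj W (tnth t i)) ->
    (forall i, f' (vsproj W (tnth t i)) = vsproj W (tnth s i)) ->
    cancel f f'.
  move=> sW fE f'E w; rewrite -[w in LHS]vsvalK -[RHS]vsvalK.
  rewrite (coord_basis sW (valP w)) !linear_sum; apply: eq_bigr => i _.
  by rewrite !linearZ -tnth_nth /= fE f'E.
exists (GLmap (Bijective (inv _ _ _ _ eW hE h'E) (inv _ _ _ _ e'W h'E hE))) => i.
by rewrite /= hE vsprojK ?(basis_mem e'W) ?mem_tnth.
Qed.

Lemma daddv_pi_eq0 (U U' : {vspace V}) u :
  (U :&: U' = 0)%VS -> u \in U' -> daddv_pi U U' u = 0.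
Proof.
move=> UU' uU'; apply: (addIr u); rewrite add0r.
have := daddv_pi_add UU' (subvP (addvSr U U') _ uU').
by rewrite (@daddv_pi_id _ _ U' U) // capvC.
Qed.

Variables W1 W2 : {vspace V}.
Hypothesis W12_direct : directv (W1 + W2).

Lemma GL_prodE (g : GL (subvs_of W1) * GL (subvs_of W2)) w1 w2 :
  w1 \in W1 -> w2 \in W2 ->
  GL_prod g (w1 + w2) = vsval (g.1 (vsproj W1 w1)) + vsval (g.2 (vsproj W2 w2)).
Proof.
move=> w1W w2W; have cap0 : (W1 :&: W2 = 0)%VS by exact/directv_addP.
have cap0' : (W2 :&: W1 = 0)%VS by rewrite capvC.
rewrite /GL_prod add_lfunE !comp_lfunE !(lfunE, linearD) /=.
rewrite (daddv_pi_id cap0 w1W) (daddv_pi_id cap0' w2W) !daddv_pi_eq0 //.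
by rewrite !linear0 !addr0 add0r.
Qed.

(** Used to pull membership in the image of a lattice back to the lattice. The two components of a
    kernel vector vanish separately because the sum is direct. *)
Lemma GL_prod_inj (g : GL (subvs_of W1) * GL (subvs_of W2)) :
  (W1 + W2)%VS = fullv -> injective (GL_prod g).
Proof.
move=> full; apply/lker0P; rewrite -subv0; apply/subvP => z.
have /memv_addP[z1 z1W [z2 z2W ->]] : z \in (W1 + W2)%VS by rewrite full memvf.
rewrite memv_ker GL_prodE // memv0 -[0 in X in X -> _]addr0.
rewrite (directv_add_unique W12_direct) ?subvsP ?mem0v // => /eqP[].
have kill W (h : GL (subvs_of W)) u : u \in W -> vsval (h (vsproj W u)) = 0 -> u = 0.
  move=> uW; rewrite -[RHS](linear0 (@vsval _ _ W)) -[in RHS](linear0 h).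
  by move=> /val_inj/(bij_inj (gl_bij h)) e; rewrite -(vsprojK uW) e linear0.
by move=> /kill-> // /kill-> //; rewrite addr0.
Qed.

End BlockMaps.

(** * Lattices as fibre products and their orbits *)

Section Fibre.
Variables (F : fieldType) (v : discrete_valuation F) (V : vectType F).
Variables W1 W2 : {vspace V}.
Local Notation O := (int_ring v).
Local Notation V_O := (restrict V v).
Local Notation icomb t := (lincomb (tnth t : _ -> V_O)).
Hypothesis W12_direct : directv (W1 + W2).
Hypothesis W12_full : (W1 + W2)%VS = fullv.

Let cap12 : (W1 :&: W2 = 0)%VS. Proof. exact/directv_addP. Qed.
Let cap21 : (W2 :&: W1 = 0)%VS. Proof. by rewrite capvC. Qed.
Let pi_add z : daddv_pi W1 W2 z + daddv_pi W2 W1 z = z.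
Proof. by apply: daddv_pi_add => //; rewrite W12_full memvf. Qed.

Lemma limg_daddv_pi (U U' : {vspace V}) :
  (U :&: U' = 0)%VS -> limg (daddv_pi U U') = U.
Proof.
move=> UU'; apply/vspaceP => u; apply/memv_imgP/idP => [[z _ ->]|uU].
  exact: memv_pi.
by exists u; rewrite ?memvf // daddv_pi_id.
Qed.

(** The family [l] lifts the basis of the projected lattice back to [L], so that coordinates on the
    projection lift linearly to elements of [L]. *)
Lemma lattice_projection_basis (U U' : {vspace V}) (L : submodClosed V_O) :
    is_lattice L -> (U :&: U' = 0)%VS ->
  exists (t : (\dim U).-tuple V) (l : 'I_(\dim U) -> submod L),
   [/\ basis_of U t,
       forall x, daddv_pi U U' (submod_val (lincomb l x)) = icomb t x
     & forall z : submod L, exists x, daddv_pi U U' (submod_val z) = icomb t x].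
Proof.
move=> Llat UU'; have [t [tB tE]] := lattice_image_basis (daddv_pi U U') Llat.
move: t tB tE; rewrite limg_daddv_pi // => t tB tE.
have /choice[l lE] i : exists z : submod L, daddv_pi U U' (submod_val z) = tnth t i.
  have [|z zL <-] := (tE (tnth t i)).2; last by exists (Submod zL).
  by exists (delta_mx 0 i); rewrite lincomb_delta.
exists t, l; split=> // [x|z].
  rewrite [submod_val _](linear_lincomb val) [LHS]linear_sum; apply: eq_bigr => i _.
  by rewrite [LHS]linearZ /= lE.
have [|a <-] := (tE (daddv_pi U U' (submod_val z))).1; last by exists a.
by exists (submod_val z) => //; exact: valP.
Qed.

Lemma Q1_class_eq0 (L : submodClosed V_O) (z : submod L) :
  @image_quot _ _ _ (daddv_pi W1 W2) L (K1 W1 L) z = 0 <->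
  (daddv_pi W1 W2 (submod_val z) : V_O) \in L.
Proof. by rewrite image_quot_eq0 !inE memv_pi andbT. Qed.

(* L is the fibre product over Q1 L of its two projections; p1 and p2 are the
   structure maps in coordinates. *)
Lemma lattice_fibre (L : submodClosed V_O) : is_lattice L ->
  exists (e1 : (\dim W1).-tuple V) (e2 : (\dim W2).-tuple V)
    (p1 : {linear 'rV[O]_(\dim W1) -> Q1 W1 W2 L})
    (p2 : {linear 'rV[O]_(\dim W2) -> Q1 W1 W2 L}),
  [/\ basis_of W1 e1 /\ basis_of W2 e2,
      forall m, exists x, p1 x = m,
      forall m, exists x, p2 x = m
    & forall z : V, z \in L <-> exists x y, z = icomb e1 x + icomb e2 y /\ p1 x = p2 y].
Proof.
move=> Llat.
have [e1 [l1 [e1B l1E e1gen]]] := lattice_projection_basis Llat cap12.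
have [e2 [l2 [e2B l2E e2gen]]] := lattice_projection_basis Llat cap21.
pose q : {linear submod L -> Q1 W1 W2 L} :=
  @image_quot _ _ _ (daddv_pi W1 W2) L (K1 W1 L).
have qE z : q z = 0 <-> (daddv_pi W1 W2 (submod_val z) : V_O) \in L.
  exact: Q1_class_eq0.
have q_surj m : exists z, q z = m by exact: image_quot_surj.
have q_eq z z' : q z = q z' <-> q (z - z') = 0.
  by rewrite linearB; split=> [->|/eqP]; rewrite ?subrr ?subr_eq0 // => /eqP.
have pi1B (z z' : submod L) : daddv_pi W1 W2 (submod_val (z - z')) =
    daddv_pi W1 W2 (submod_val z) - daddv_pi W1 W2 (submod_val z').
  exact: (linearB (daddv_pi W1 W2)).
have pi2B (z z' : submod L) : daddv_pi W2 W1 (submod_val (z - z')) =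
    daddv_pi W2 W1 (submod_val z) - daddv_pi W2 W1 (submod_val z').
  exact: (linearB (daddv_pi W2 W1)).
have q1 (z : submod L) x : daddv_pi W1 W2 (submod_val z) = icomb e1 x ->
    q (lincomb l1 x) = q z.
  by move=> e; apply/q_eq/qE; rewrite pi1B l1E e subrr rpred0.
(* An element [d] of [L] with zero second projection equals its first projection, so its class in
   [Q1] is zero. Hence [q] factors through the second projection too, and [Q2] can be avoided. *)
have q2 (z : submod L) y : daddv_pi W2 W1 (submod_val z) = icomb e2 y ->
    q (lincomb l2 y) = q z.
  move=> e; apply/q_eq/qE; set d := _ - _.
  have : daddv_pi W2 W1 (submod_val d) = 0 by rewrite pi2B l2E e subrr.
  have := pi_add (submod_val d) => + d0; rewrite d0 addr0 => ->.
  exact: valP.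
exists e1, e2, (q \o lincomb l1)%FUN, (q \o lincomb l2)%FUN; split=> //.
- by move=> m; have [z <-] := q_surj m; have [x /q1 <-] := e1gen z; exists x.
- by move=> m; have [z <-] := q_surj m; have [x /q2 <-] := e2gen z; exists x.
move=> z; split=> [zL|[x [y [-> /= pxy]]]].
  have [x xE] := e1gen (Submod zL); have [y yE] := e2gen (Submod zL).
  exists x, y; rewrite /= (q1 _ _ xE) (q2 _ _ yE); split=> //.
  by rewrite -xE -yE pi_add.
(* Equality of classes puts [icomb e1 x] minus the first projection of [b] in [L]. Adding [b] leaves
   [icomb e1 x + icomb e2 y]. *)
move/q_eq/qE: pxy; rewrite pi1B l1E => pxy.
set b := lincomb l2 y in pxy *.
have bL : (submod_val b : V_O) \in L by exact: valP.
have := rpredD pxy bL; rewrite -[X in _ + X](pi_add (submod_val b)) l2E addrA.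
by rewrite subrK.
Qed.

Lemma GL_prod_lincomb n1 n2 (e1 e1' : n1.-tuple V) (e2 e2' : n2.-tuple V) :
    basis_of W1 e1 -> basis_of W1 e1' -> basis_of W2 e2 -> basis_of W2 e2' ->
  exists g : GL (subvs_of W1) * GL (subvs_of W2), forall x y,
    GL_prod g (icomb e1 x + icomb e2 y) = icomb e1' x + icomb e2' y.
Proof.
move=> e1B e1'B e2B e2'B.
have [g1 g1E] := GL_of_bases e1B e1'B; have [g2 g2E] := GL_of_bases e2B e2'B.
exists (g1, g2) => x y; rewrite GL_prodE //.
- have cE (U : {vspace V}) n (e e' : n.-tuple V) (h : GL (subvs_of U)) (a : 'rV[O]_n) :
      (forall i, vsval (h (vsproj U (tnth e i))) = tnth e' i) ->
      vsval (h (vsproj U (icomb e a))) = icomb e' a.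
    (* The integer ring acts through [int_val], so the combination is by conversion an [F]-linear
       one. *)
    move=> hE; have -> : icomb e a = \sum_i int_val (a 0 i) *: (tnth e i : V) by [].
    by rewrite !linear_sum; apply: eq_bigr => i _; rewrite !linearZ /= hE.
  by rewrite (cE _ _ _ _ _ _ g1E) (cE _ _ _ _ _ _ g2E).
- by rewrite -(span_basis e1B) lincomb_span.
- by rewrite -(span_basis e2B) lincomb_span.
Qed.

(** A block-diagonal map commutes with the projection onto [W1]. Both modules are therefore images
    of [L], and injectivity of the map makes the kernels agree. *)
Lemma Q1_GL (g : GL (subvs_of W1) * GL (subvs_of W2)) (L : submodClosed V_O) :
  lmod_iso (Q1 W1 W2 L) (Q1 W1 W2 (submod_image (GL_prod g) L)).
Proof.
set gL := submod_image (GL_prod g) L.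
have pi_g z : daddv_pi W1 W2 (GL_prod g z) = GL_prod g (daddv_pi W1 W2 z).
  rewrite -[z in LHS]pi_add GL_prodE ?memv_pi // linearD /=.
  rewrite daddv_pi_id ?subvsP // [X in _ + X]daddv_pi_eq0 ?subvsP // addr0.
  rewrite -[daddv_pi W1 W2 z in RHS]addr0 GL_prodE ?memv_pi ?mem0v //.
  by rewrite !linear0 addr0.
apply: (@lmod_iso_ker _ (submod L) (Q1 W1 W2 L) (Q1 W1 W2 gL)
  (@image_quot _ _ _ (daddv_pi W1 W2) L (K1 W1 L))
  (@image_quot _ _ _ (daddv_pi W1 W2) gL (K1 W1 gL) \o
    @image_map _ _ _ (GL_prod g) L)%FUN).
- exact: image_quot_surj.
- move=> y; have [z <-] := image_quot_surj y.
  by have [x <-] := image_map_surj z; exists x.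
move=> x /=; rewrite !Q1_class_eq0 /= pi_g.
split=> [h|/asboolP[y yL /GL_prod_inj-> //]].
by apply/asboolP; exists (daddv_pi W1 W2 (submod_val x)).
Qed.

Lemma lattices_same_orbit (L L' : submodClosed V_O) :
    is_lattice L -> is_lattice L' -> lmod_iso (Q1 W1 W2 L) (Q1 W1 W2 L') ->
  exists g : GL (subvs_of W1) * GL (subvs_of W2), submod_image (GL_prod g) L = L'.
Proof.
move=> /lattice_fibre[e1 [e2 [p1 [p2 [[e1B e2B] p1s p2s LE]]]]].
move=> /lattice_fibre[f1 [f2 [q1 [q2 [[f1B f2B] q1s q2s L'E]]]]] [psi psiB].
have [k [phi [phi_surj phi_unit]]] := residue_field_exists v.
(* Both lifts are taken over the same [psi], so [p1 x = p2 y] holds exactly when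
   [q1 (x G1) = q2 (y G2)]. *)
have [G1 [Z1 [GZ1 ZG1 G1E]]] := lift_iso_free phi_surj phi_unit p1s q1s psiB.
have [G2 [Z2 [GZ2 ZG2 G2E]]] := lift_iso_free phi_surj phi_unit p2s q2s psiB.
(* In the bases [f1'] and [f2'], sending basis to basis acts on coordinates as right multiplication
   by [G1] and [G2]. *)
have [f1' [f1'B f1'E]] := basis_change f1B ZG1.
have [f2' [f2'B f2'E]] := basis_change f2B ZG2.
have [g gE] := GL_prod_lincomb e1B f1'B e2B f2'B.
exists g; apply/submodClosed_eq => z; apply/asboolP/idP.
  move=> [_ /LE[x [y [-> pxy]]] ->]; apply/L'E.
  by exists (x *m G1), (y *m G2); rewrite G1E G2E pxy gE f1'E f2'E.
move=> /L'E[x [y [-> qxy]]].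
exists (icomb e1 (x *m Z1) + icomb e2 (y *m Z2)).
  apply/LE; exists (x *m Z1), (y *m Z2); split=> //.
  by apply: (bij_inj psiB); rewrite -G1E -G2E -!mulmxA ZG1 ZG2 !mulmx1.
by rewrite gE f1'E f2'E -!mulmxA ZG1 ZG2 !mulmx1.
Qed.

End Fibre.

(** * From lattices to vertices *)

Theorem corollary2p5 (F : fieldType) (v : discrete_valuation F)
    (residue_finite : finite_set [set: residue_field v]%classic)
    (V : vectType F) (W1 W2 : {vspace V})
    (W1_neq0 : W1 <> 0%VS) (W2_neq0 : W2 <> 0%VS)
    (W12_direct : directv (W1 + W2)) (W12_full : (W1 + W2)%VS = fullv)
    (x y : set (submodClosed (restrict V v)))
    (x_vertex : is_vertex x) (y_vertex : is_vertex y) :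
  (exists g : GL (subvs_of W1) * GL (subvs_of W2), GL_act g x = y) <->
  Q_vertex W1 W2 x = Q_vertex W1 W2 y.
Proof.
case: x_vertex => L Llat ->; case: y_vertex => L' L'lat ->.
split=> [[g]|].
  rewrite GL_act_class => <-; rewrite !Q_vertex_class; apply/funext => N.
  have gL := Q1_GL W12_direct W12_full g L.
  apply/propext; split; last exact: lmod_iso_trans.
  exact/lmod_iso_trans/lmod_iso_sym.
rewrite !Q_vertex_class => QE.
(* Evaluating the two equal classes at [Q1 W1 W2 L'] yields the isomorphism. The resulting [g] maps
   [L] to [L'] itself, and [GL_act_class] extends this to homothety classes. *)
have /(lattices_same_orbit W12_direct W12_full Llat L'lat)[g gL] :
    lmod_iso (Q1 W1 W2 L) (Q1 W1 W2 L').
  by rewrite -/(iso_class _ _) QE; exact: lmod_iso_refl.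
by exists g; rewrite GL_act_class gL.
Qed.
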